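(* Let $\lambda^0,\lambda^1\in P$. Suppose that $(x^0,y^0)$ is an optimal solution to $(P_{\lambda^0})$, found using the outer approximation (OA) algorithm with $\Omega(\mathcal X^0,\lambda^0)$ as the linear relaxation, where $\mathcal X^0\subset\mathbb R^n\times\mathbb Z^m$ is a finite set of linearization points, so that $(x^0,y^0)\in\mathcal X^0$. Suppose that, to solve $(P_{\lambda^1})$, the OA algorithm is started with $y^0$ as the integer assignment and $\mathcal X^0$ as the set of linearization points. Let $x^1$ be an optimal solution to $\mathrm{NLP}(y^0,\lambda^1)$, and let $\mathcal X^1=\mathcal X^0\cup\{(x^1,y^0)\}$. If there is $\hat x\in\mathbb R^n$ such that $(\hat x,y^0)$ is an optimal solution to $\mathrm{MILP}(\mathcal X^1,\lambda^1)$, then $(x^1,y^0)$ is an optimal solution to $(P_{\lambda^1})$, and the OA algorithm for $(P_{\lambda^1})$ has converged (after this first iteration, its upper bound $c^\top x^1+d^\top y^0$ equals its lower bound, the optimal value of $\mathrm{MILP}(\mathcal X^1,\lambda^1)$).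
   Context: Setting. $[p]:=\{1,\dots,p\}$. Let $P\subset\mathbb R^k$ be nonempty and connected. For $\lambda\in P$, the problem $(P_\lambda)$ is: minimize $c^\top x+d^\top y$ subject to $g^\lambda(x,y)\le 0$, $h(x,y)\le 0$, $Ax+By\le b$, $x\in\mathbb R^n$, $y\in\mathbb Z^m$, where $c\in\mathbb R^n$, $d\in\mathbb R^m$, $g^\lambda:\mathbb R^{n+m}\to\mathbb R^p$, $h:\mathbb R^{n+m}\to\mathbb R^q$, $A\in\mathbb R^{r\times n}$, $B\in\mathbb R^{r\times m}$, $b\in\mathbb R^r$; vector inequalities are componentwise. $\mathcal F_\lambda\subset\mathbb R^n\times\mathbb Z^m$ denotes its feasible set. Standing assumptions. For every $\lambda\in P$, each component of $g^\lambda$ and $h$ is convex and continuously differentiable on $\mathbb R^{n+m}$. The set $\mathcal F_L:=\{(x,y)\in\mathbb R^{n+m}\mid Ax+By\le b\}$ is nonempty and bounded. For all $(x,y)\in\mathcal F_L$, the map $\lambda\mapsto g^\lambda(x,y)$ is continuous on $P$. For every $\lambda\in P$ and every $\hat y\in\mathbb Z^m$ such that $\mathrm{NLP}(\hat y,\lambda)$ below is feasible, the linear independence constraint qualification (LICQ) holds at all its optimal solutions, i.e. the gradients with respect to $x$ of all active constraints (among the components of $g^\lambda(\cdot,\hat y)\le0$, $h(\cdot,\hat y)\le0$ and $A x+B\hat y\le b$) are linearly independent. Subproblems. For $\hat y\in\mathbb Z^m$, $\mathrm{NLP}(\hat y,\lambda)$ is: minimize $c^\top x+d^\top\hat y$ over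 $x\in\mathbb R^n$ subject to $(x,\hat y)\in\mathcal F_\lambda$. $\mathrm{NLP\text{-}Feas}(\hat y,\lambda)$ is: minimize $t$ over $(t,x)\in\mathbb R\times\mathbb R^n$ subject to $g^\lambda_i(x,\hat y)\le t$ for all $i\in[p]$, $h_i(x,\hat y)\le t$ for all $i\in[q]$, $Ax+B\hat y\le b$. For a differentiable $f:\mathbb R^{n+m}\to\mathbb R$, its linearization at $(\bar x,\bar y)$ is $\tilde f^{(\bar x,\bar y)}(x,y):=f(\bar x,\bar y)+\nabla f(\bar x,\bar y)^\top\begin{pmatrix}x-\bar x\\ y-\bar y\end{pmatrix}$. For a finite set $\mathcal X\subset\mathbb R^n\times\mathbb Z^m$ (the linearization points), $\Omega(\mathcal X,\lambda)$ is the set of all $(x,y)\in\mathbb R^n\times\mathbb Z^m$ with $Ax+By\le b$ such that, for every $(\bar x,\bar y)\in\mathcal X$, the linearizations at $(\bar x,\bar y)$ of all components $g^\lambda_j$ ($j\in[p]$) and $h_j$ ($j\in[q]$) are $\le 0$ at $(x,y)$. $\mathrm{MILP}(\mathcal X,\lambda)$ is: minimize $c^\top x+d^\top y$ subject to $(x,y)\in\Omega(\mathcal X,\lambda)$. OA algorithm for $(P_\lambda)$. Input: an initial integer assignment $y^{(0)}\in\mathbb Z^m$, an initial finite set of linearization points $\mathcal X^{(0)}$ (possibly empty), and a tolerance $\varepsilon\ge 0$. Set $LB=-\infty$, $UB=+\infty$. In iteration $s=0,1,2,\dots$: if $\mathrm{NLP}(y^{(s)},\lambda)$ is feasible, let $x^{(s)}$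 be an optimal solution and $f^{(s)}$ its optimal value, and if $f^{(s)}<UB$ set $UB:=f^{(s)}$ and store $(x^{(s)},y^{(s)})$ as incumbent; otherwise let $x^{(s)}$ be the $x$-part of an optimal solution of $\mathrm{NLP\text{-}Feas}(y^{(s)},\lambda)$. Set $\mathcal X^{(s+1)}:=\mathcal X^{(s)}\cup\{(x^{(s)},y^{(s)})\}$, solve $\mathrm{MILP}(\mathcal X^{(s+1)},\lambda)$, let $LB$ be its optimal value and let $y^{(s+1)}$ be the integer part of the optimal solution found. Stop when $UB-LB\le\varepsilon$, returning the incumbent and the set of linearization points. The algorithm is said to have converged when $UB=LB$. *)

(* Defs.v *)
From mathcomp Require Import all_boot all_order all_algebra.
From mathcomp Require Import all_classical all_reals all_analysis.

Set Implicit Arguments.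
Unset Strict Implicit.
Unset Printing Implicit Defensive.

Import Order.TTheory GRing.Theory Num.Theory.
Import numFieldNormedType.Exports.

Local Open Scope classical_set_scope.
Local Open Scope ring_scope.

Definition levec {R : realType} {N : nat} (u v : 'cV[R]_N) : Prop :=
  forall i, u i 0 <= v i 0.

Definition dotmul {R : realType} {N : nat} (u v : 'cV[R]_N) : R :=
  (u^T *m v) 0 0.

Definition grad {R : realType} {N : nat} (f : 'cV[R]_N -> R) (z : 'cV[R]_N) :
    'cV[R]_N :=
  \col_i 'D_(delta_mx i 0) f z.

Definition cont_diff {R : realType} {N : nat} (f : 'cV[R]_N -> R) : Prop :=
  (forall z, differentiable f z) /\ continuous (grad f).

Definition linearization {R : realType} {N : nat} (f : 'cV[R]_N -> R)
    (zbar z : 'cV[R]_N) : R :=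
  f zbar + dotmul (grad f zbar) (z - zbar).

Definition is_minimizer {R : realType} {T : Type} (F : set T) (obj : T -> R)
    (z : T) : Prop :=
  F z /\ forall w, F w -> obj z <= obj w.

Definition opt_value {R : realType} {T : Type} (F : set T) (obj : T -> R) :
    \bar R :=
  ereal_inf [set (obj z)%:E | z in F].

(* The parameter set together with the data of the whole family of problems.
   The map `pg` is total in the parameter, but only its values on `pP`
   are constrained or used. *)
Record minlp (R : realType) (n m k p q r : nat) := Minlp {
  pP : set 'cV[R]_k ;
  pc : 'cV[R]_n ;
  pd : 'cV[R]_m ;
  pg : 'cV[R]_k -> 'cV[R]_(n + m) -> 'cV[R]_p ;
  ph : 'cV[R]_(n + m) -> 'cV[R]_q ;
  pA : 'M[R]_(r, n) ;
  pB : 'M[R]_(r, m) ;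
  pb : 'cV[R]_r
}.

Section Problems.
Context {R : realType} {n m k p q r : nat} (Q : minlp R n m k p q r).

(* Points of R^n x Z^m; integrality is enforced by the type. *)
Definition mpoint : Type := ('cV[R]_n * 'cV[int]_m)%type.

Definition toR (y : 'cV[int]_m) : 'cV[R]_m := map_mx intr y.

Definition emb (z : mpoint) : 'cV[R]_(n + m) := col_mx z.1 (toR z.2).

Definition objective (z : mpoint) : R :=
  dotmul (pc Q) z.1 + dotmul (pd Q) (toR z.2).

Definition lin_lhs (z : 'cV[R]_(n + m)) : 'cV[R]_r :=
  pA Q *m usubmx z + pB Q *m dsubmx z.

Definition FL : set 'cV[R]_(n + m) := [set z | levec (lin_lhs z) (pb Q)].

Definition feasible (lam : 'cV[R]_k) : set mpoint :=
  [set z | [/\ levec (pg Q lam (emb z)) 0, levec (ph Q (emb z)) 0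
             & FL (emb z)]].

Definition NLP_set (yhat : 'cV[int]_m) (lam : 'cV[R]_k) : set 'cV[R]_n :=
  [set x | feasible lam (x, yhat)].

Definition NLP_obj (yhat : 'cV[int]_m) (x : 'cV[R]_n) : R :=
  objective (x, yhat).

Definition NLPfeas_set (yhat : 'cV[int]_m) (lam : 'cV[R]_k) :
    set (R * 'cV[R]_n) :=
  [set tx | [/\ levec (pg Q lam (emb (tx.2, yhat))) (const_mx tx.1),
                levec (ph Q (emb (tx.2, yhat))) (const_mx tx.1)
              & FL (emb (tx.2, yhat))]].

Definition Omega (X : set mpoint) (lam : 'cV[R]_k) : set mpoint :=
  [set z | FL (emb z) /\
     forall zbar, X zbar ->
       (forall j, linearization (fun w => pg Q lam w j 0)
                    (emb zbar) (emb z) <= 0) /\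
       (forall j, linearization (fun w => ph Q w j 0)
                    (emb zbar) (emb z) <= 0)].

(* All constraints in the form `constr lam j z <= 0`. *)
Definition constr (lam : 'cV[R]_k) (j : 'I_p + 'I_q + 'I_r)
    (z : 'cV[R]_(n + m)) : R :=
  match j with
  | inl (inl i) => pg Q lam z i 0
  | inl (inr i) => ph Q z i 0
  | inr i => (lin_lhs z - pb Q) i 0
  end.

(* `free` is applied to an indexed family: two active constraints with the
   same gradient violate the condition. *)
Definition LICQ (yhat : 'cV[int]_m) (lam : 'cV[R]_k) (x : 'cV[R]_n) : Prop :=
  free [seq grad (fun u => constr lam j (emb (u, yhat))) x
       | j : 'I_p + 'I_q + 'I_r in
         [pred j : 'I_p + 'I_q + 'I_r | constr lam j (emb (x, yhat)) == 0]].

Record standing_assumptions : Prop := StandingAssumptions {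
  sa_P_nonempty : pP Q !=set0 ;
  sa_P_connected : connected (pP Q) ;
  sa_g_convex : forall lam, pP Q lam -> forall i : 'I_p,
    convex_function (E := 'cV[R]_(n + m)) setT (fun z => pg Q lam z i 0) ;
  sa_g_C1 : forall lam, pP Q lam -> forall i : 'I_p,
    cont_diff (fun z => pg Q lam z i 0) ;
  sa_h_convex : forall i : 'I_q,
    convex_function (E := 'cV[R]_(n + m)) setT (fun z => ph Q z i 0) ;
  sa_h_C1 : forall i : 'I_q, cont_diff (fun z => ph Q z i 0) ;
  sa_FL_nonempty : FL !=set0 ;
  sa_FL_bounded : bounded_set FL ;
  sa_g_param : forall z, FL z -> {within pP Q, continuous (pg Q ^~ z)} ;
  sa_LICQ : forall lam, pP Q lam -> forall yhat x,
    is_minimizer (NLP_set yhat lam) (NLP_obj yhat) x -> LICQ yhat lam x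
}.

Record oa_state := OAState {
  oa_y : 'cV[int]_m ;
  oa_X : set mpoint ;
  oa_LB : \bar R ;
  oa_UB : \bar R ;
  oa_inc : option mpoint
}.

Definition oa_init (y : 'cV[int]_m) (X : set mpoint) : oa_state :=
  OAState y X -oo%E +oo%E None.

(* The subproblem solution `x` computed at state `S`, with the resulting upper
   bound `UB` and incumbent `inc`. *)
Definition oa_subproblem (lam : 'cV[R]_k) (S : oa_state) (x : 'cV[R]_n)
    (UB : \bar R) (inc : option mpoint) : Prop :=
  let y := oa_y S in
  (NLP_set y lam !=set0 ->
     let f := opt_value (NLP_set y lam) (NLP_obj y) in
     [/\ is_minimizer (NLP_set y lam) (NLP_obj y) x,
         UB = (if (f < oa_UB S)%E then f else oa_UB S)
       & inc = (if (f < oa_UB S)%E then Some (x, y) else oa_inc S)]) /\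
  (~ (NLP_set y lam !=set0) ->
     [/\ exists t, is_minimizer (NLPfeas_set y lam) fst (t, x),
         UB = oa_UB S
       & inc = oa_inc S]).

(* One full iteration from `S` to `S'`, in which the subproblem solution
   is `x`. It is a relation because optimal solutions need not be unique. *)
Definition oa_iter (lam : 'cV[R]_k) (S : oa_state) (x : 'cV[R]_n)
    (S' : oa_state) : Prop :=
  [/\ oa_subproblem lam S x (oa_UB S') (oa_inc S'),
      oa_X S' = oa_X S `|` [set (x, oa_y S)],
      oa_LB S' = opt_value (Omega (oa_X S') lam) objective
    & exists xm, is_minimizer (Omega (oa_X S') lam) objective (xm, oa_y S')].

Definition oa_stop (eps : R) (S : oa_state) : Prop :=
  (oa_UB S - oa_LB S <= eps%:E)%E.

Definition oa_converged (S : oa_state) : Prop := oa_UB S = oa_LB S.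

(* The test `oa_stop` is never passed by an initial state, since
   there UB - LB = +oo. *)
Inductive oa_reach (lam : 'cV[R]_k) (eps : R) (S0 : oa_state) :
    oa_state -> Prop :=
| oa_reach0 : oa_reach lam eps S0 S0
| oa_reachS S x S' : oa_reach lam eps S0 S -> ~ oa_stop eps S ->
    oa_iter lam S x S' -> oa_reach lam eps S0 S'.

Definition oa_returns (lam : 'cV[R]_k) (eps : R) (y : 'cV[int]_m)
    (Xinit : set mpoint) (z : mpoint) (X : set mpoint) : Prop :=
  exists S, [/\ oa_reach lam eps (oa_init y Xinit) S, oa_stop eps S,
                oa_inc S = Some z & oa_X S = X].

End Problems.

(* Main.v *)
(* By convexity, every feasible point of the new problem satisfies all the
   linearized constraints, so MILP(X1, lam1) is a relaxation of it. On the slice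
   y = y0 the relaxation is no better than x1: a point xhat of Omega(X1, lam1)
   on that slice gives a direction xhat - x1 along which no active constraint
   of NLP(y0, lam1) at x1 increases to first order, and under LICQ optimality
   of x1 excludes descent along such a direction. Hence (x1, y0) solves
   MILP(X1, lam1), and both bounds equal its objective value. *)
Require Import Defs.
From mathcomp Require Import all_boot all_order all_algebra.
From mathcomp Require Import all_classical all_reals all_analysis.
From mathcomp Require Import ring.

Set Implicit Arguments.
Unset Strict Implicit.

Import Order.TTheory GRing.Theory Num.Theory.
Import numFieldNormedType.Exports.
Local Open Scope classical_set_scope.
Local Open Scope ring_scope.

(** * Dot products, gradients and derivatives along affine slices *)

Lemma dotmulE (R : realType) (N : nat) (u v : 'cV[R]_N) :
  dotmul u v = \sum_i u i 0 * v i 0.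
Proof. by rewrite /dotmul mxE; apply: eq_bigr => i _; rewrite mxE. Qed.

Lemma dotmulDr (R : realType) (N : nat) (u v w : 'cV[R]_N) :
  dotmul u (v + w) = dotmul u v + dotmul u w.
Proof. by rewrite /dotmul mulmxDr mxE. Qed.

Lemma dotmulZr (R : realType) (N : nat) (a : R) (u v : 'cV[R]_N) :
  dotmul u (a *: v) = a * dotmul u v.
Proof. by rewrite /dotmul -scalemxAr mxE. Qed.

Section Slices.
Context {R : realType} {N n : nat}.
Context (f : 'cV[R]_N -> R) (M : 'M[R]_(N, n)) (a : 'cV[R]_N).
Let slice (u : 'cV[R]_n) := f (M *m u + a).

(** An affine map turns the step [h *: v] into exactly [h *: (M *m v)], so derivatives of a slice
    are read off from those of [f]. *)
Let quotient_slice (x v : 'cV[R]_n) :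
  (fun h : R => h^-1 *: ((slice \o shift x) (h *: v) - slice x)) =
  (fun h : R => h^-1 *: ((f \o shift (M *m x + a)) (h *: (M *m v)) -
                         f (M *m x + a))).
Proof.
by apply/funext => h /=; rewrite /slice mulmxDr -scalemxAr addrA.
Qed.

Lemma is_derive_slice (x v : 'cV[R]_n) : differentiable f (M *m x + a) ->
  is_derive x v slice ('D_(M *m v) f (M *m x + a)).
Proof.
move=> df; apply: DeriveDef; last by rewrite /derive quotient_slice.
by rewrite /derivable quotient_slice; exact: diff_derivable.
Qed.

Lemma dotmul_grad_slice (x v : 'cV[R]_n) : differentiable f (M *m x + a) ->
  dotmul (grad slice x) v = 'D_(M *m v) f (M *m x + a).
Proof.
move=> df; rewrite dotmulE deriveE//.
rewrite [in RHS](matrix_sum_delta v) mulmx_sumr linear_sum.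
apply: eq_bigr => i _; rewrite big_ord1 -scalemxAr linearZ /= mxE mulrC.
rewrite (derive_val (is_derive := is_derive_slice (delta_mx i 0) df)).
by rewrite deriveE.
Qed.

End Slices.

Lemma dotmul_grad (R : realType) (N : nat) (f : 'cV[R]_N -> R)
    (z w : 'cV[R]_N) :
  differentiable f z -> dotmul (grad f z) w = 'D_w f z.
Proof.
move=> df; have := @dotmul_grad_slice R N N f 1%:M 0 z w.
rewrite !mul1mx addr0 => <- //; congr (dotmul (grad _ z) w).
by apply/funext => u; rewrite mul1mx addr0.
Qed.

(** * One-sided first-order behaviour along a ray *)

Lemma derivative_at_right (R : realType) (V : normedModType R) (f : V -> R)
    (z v : V) (d : R) : is_derive z v f d ->
  h^-1 * (f (z + h *: v) - f z) @[h --> 0^'+] --> d.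
Proof.
move=> df; apply: cvg_dnbhs_at_right.
rewrite -(derive_val (is_derive := df)) [X in X @ _](_ : _ =
  (fun h => h^-1 *: ((f \o shift z) (h *: v) - f z))).
  exact: (ex_derive (is_derive := df)).
by apply/funext => h /=; rewrite (addrC z).
Qed.

Lemma near_ray_le0 (R : realType) (V : normedModType R) (f : V -> R)
    (z v : V) (d : R) : is_derive z v f d ->
  f z <= 0 -> (f z = 0 -> d < 0) ->
  \forall h \near 0^'+, f (z + h *: v) <= 0.
Proof.
move=> df; rewrite le_eqVlt => /predU1P[fz0 /(_ fz0) d0|fz0 _].
  have /cvgr_lt /(_ 0 d0) q0 := derivative_at_right df.
  apply: filterS2 q0 (nbhs_right_gt 0) => h.
  by rewrite fz0 subr0 => + h0; rewrite pmulr_rlt0 ?invr_gt0// => /ltW.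
(* Inactive case: differentiability in the single variable [h] gives continuity along the ray, which
   keeps [f] negative for small steps. *)
have /derivable1P/derivable1_diffP/differentiable_continuous :=
  ex_derive (is_derive := df).
move=> /cvg_at_right_filter /cvgr_lt; rewrite scale0r add0r => /(_ 0 fz0).
by apply: filterS => h /ltW; rewrite addrC.
Qed.

(** Convexity on the segment from [zbar] to [z] bounds every difference quotient with [0 < h <= 1]
    by [f z - f zbar]; the bound survives the limit [h -> 0+]. *)
Lemma linearization_le (R : realType) (N : nat) (f : 'cV[R]_N -> R)
    (zbar z : 'cV[R]_N) :
  convex_function (E := 'cV[R]_N) setT f -> differentiable f zbar ->
  linearization f zbar z <= f z.
Proof.
move=> cf df; rewrite /linearization dotmul_grad// -lerBrDl.
have dD : is_derive zbar (z - zbar) f ('D_(z - zbar) f zbar).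
  by apply: DeriveDef => //; exact: diff_derivable.
apply: (cvgr_to_le (derivative_at_right dD)).
near=> h.
have h0 : 0 < h by near: h; exact: nbhs_right_gt.
have h1 : h <= 1 by near: h; exact: nbhs_right_ltW.
rewrite mulrC ler_pdivrMr//.
have H : f (h *: z + (1 - h) *: zbar) <= h * f z + (1 - h) * f zbar.
  exact: (cf (Itv01 (ltW h0) h1) z zbar (mem_set I) (mem_set I)).
rewrite (_ : zbar + _ = h *: z + (1 - h) *: zbar).
  by rewrite lerBlDr (le_trans H)// le_eqVlt; apply/orP; left; apply/eqP; ring.
by apply/colP => i; rewrite !mxE; ring.
Unshelve. all: by end_near.
Qed.

(** * First-order optimality under linear independence *)

Lemma free_dotmul_solve (R : realType) (n : nat) (X : seq 'cV[R]_n) (a : R) :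
  free X -> exists w, forall u, u \in X -> dotmul u w = a.
Proof.
move=> /(freeP (X := in_tuple X)) fX.
(* The vectors of [X] become the rows of [M]; their independence yields a right inverse [B], and [B]
   applied to a constant vector solves the system. *)
pose M : 'M[R]_(size X, n) := \matrix_(i, j) X`_i j 0.
have /row_freeP[B MB] : row_free M.
  apply: inj_row_free => c cM; apply/rowP => i; rewrite mxE.
  apply: (fX (fun i => c 0 i)); apply/colP => j; rewrite summxE mxE.
  move/rowP: cM => /(_ j); rewrite !mxE => cMj; rewrite -[RHS]cMj.
  by apply: eq_bigr => l _; rewrite !mxE.
pose w : 'cV[R]_n := B *m const_mx a; exists w => u uX.
have iX : (index u X < size X)%N by rewrite index_mem.
have /colP/(_ (Ordinal iX)) : M *m w = const_mx a by rewrite mulmxA MB mul1mx.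
rewrite !mxE => <-; rewrite dotmulE; apply: eq_bigr => j _.
by rewrite [M _ _]mxE /= nth_index.
Qed.

Lemma exists_pos_add_mul_lt0 (R : realFieldType) (a b : R) : a < 0 ->
  exists2 e, 0 < e & a + e * b < 0.
Proof.
move=> a0; have b1 : 0 < 1 + `|b| by rewrite ltr_pwDl.
(* The summand 1 keeps the denominator positive when [b = 0] and makes [b < 1 + |b|] strict. *)
exists (- a / (1 + `|b|)); first by rewrite divr_gt0 ?oppr_gt0.
rewrite -ltrBrDl sub0r mulrAC ltr_pdivrMr// ltr_pM2l ?oppr_gt0//.
by rewrite (le_lt_trans (ler_norm b))// ltrDr.
Qed.

(* No multipliers are needed: if [v] were a descent direction, adding a small
   multiple of a solution [w] of [grad (F j) x . w = -1] over the active [j]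
   would make it a strictly feasible descent direction. *)
Lemma free_active_grad_dotmul_ge0 (R : realType) (n : nat) (T : finType)
    (F : T -> 'cV[R]_n -> R) (c x v : 'cV[R]_n) :
  (forall j u, is_derive x u (F j) (dotmul (grad (F j) x) u)) ->
  free [seq grad (F j) x | j : T in [pred j | F j x == 0]] ->
  is_minimizer [set u | forall j, F j u <= 0] (dotmul c) x ->
  (forall j, F j x = 0 -> dotmul (grad (F j) x) v <= 0) ->
  0 <= dotmul c v.
Proof.
move=> dF fF [Fx xmin] vF; rewrite leNgt; apply/negP => cv0.
have [w wF] := free_dotmul_solve (-1) fF.
have [e e0 ce] := exists_pos_add_mul_lt0 (dotmul c w) cv0.
(* The constraints are finitely many, so a single range of small steps serves all of them. *)
have : \forall h \near 0^'+, forall j, F j (x + h *: (v + e *: w)) <= 0.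
  apply: filter_forall => j; apply: near_ray_le0 (dF j _) (Fx j) _ => Fj0.
  rewrite dotmulDr dotmulZr wF.
    by rewrite mulrN1 (le_lt_trans (lerB (vF j Fj0) (lexx e)))// sub0r oppr_lt0.
  by apply: (fintype.image_f (fun j => grad (F j) x)); rewrite inE; apply/eqP.
move=> /filterI /(_ (nbhs_right_gt 0)) /filter_ex[h [/xmin + h0]].
apply/negP; rewrite -ltNge dotmulDr gtrDl dotmulZr dotmulDr dotmulZr.
by rewrite pmulr_rlt0.
Qed.

Lemma opt_valueE (R : realType) (T : Type) (F : set T) (obj : T -> R) (z : T) :
  is_minimizer F obj z -> opt_value F obj = (obj z)%:E.
Proof.
move=> [Fz zmin]; apply/eqP; rewrite eq_le; apply/andP; split.
  by apply: ereal_inf_lbound; exists z.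
by apply: le_ereal_inf_tmp => _ [w Fw <-]; rewrite lee_fin zmin.
Qed.

(** * The relaxation [Omega] and its restriction to one integer assignment *)

Section OuterApproximation.
Context {R : realType} {n m k p q r : nat} (Q : minlp R n m k p q r).
Context (HQ : standing_assumptions Q).

Let embx : 'M[R]_(n + m, n) := col_mx 1%:M 0.

Let embE (x : 'cV[R]_n) (y : 'cV[int]_m) :
  emb (x, y) = embx *m x + col_mx 0 (toR y).
Proof. by rewrite /emb mul_col_mx mul1mx mul0mx add_col_mx addr0 add0r. Qed.

Lemma constr_lin_le0 (lam : 'cV[R]_k) i (z : 'cV[R]_(n + m)) :
  (constr Q lam (inr i) z <= 0) = (lin_lhs Q z i 0 <= pb Q i 0).
Proof. by rewrite /= mxE [(- pb Q) i 0]mxE subr_le0. Qed.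

Lemma feasible_constr (lam : 'cV[R]_k) (z : @mpoint R n m) :
  feasible Q lam z <-> forall j, constr Q lam j (emb z) <= 0.
Proof.
split=> [[gz hz bz] [[i|i]|i]|cz].
- by have := gz i; rewrite /= mxE.
- by have := hz i; rewrite mxE.
- by rewrite (constr_lin_le0 lam); exact: bz.
split=> i.
- by rewrite mxE; exact: (cz (inl (inl i))).
- by rewrite mxE; exact: (cz (inl (inr i))).
- by rewrite -(constr_lin_le0 lam).
Qed.

(** The block form displays a linear constraint as an affine function of the whole vector [z], as
    convexity and differentiability require. *)
Lemma constr_linE (lam : 'cV[R]_k) i (z : 'cV[R]_(n + m)) :
  constr Q lam (inr i) z = (row_mx (pA Q) (pB Q) *m z - pb Q) i 0.
Proof. by rewrite /= /lin_lhs -mul_row_col vsubmxK. Qed.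

Lemma constr_convex (lam : 'cV[R]_k) (j : 'I_p + 'I_q + 'I_r) : pP Q lam ->
  convex_function (E := 'cV[R]_(n + m)) setT (constr Q lam j).
Proof.
move=> Plam; case: j => [[i|i]|i].
- exact: (sa_g_convex HQ Plam).
- exact: (sa_h_convex HQ).
move=> t u v _ _.
(* For an affine function the convexity inequality is an equality. *)
suff -> : constr Q lam (inr i) (conv t u v) =
  t%:num * constr Q lam (inr i) u + (1 - t%:num) * constr Q lam (inr i) v by [].
rewrite !constr_linE /conv /=.
rewrite mulmxDr -!scalemxAr !mxE.
by rewrite /unstable.onem; ring.
Qed.

Lemma constr_differentiable (lam : 'cV[R]_k) (j : 'I_p + 'I_q + 'I_r) z :
  pP Q lam -> differentiable (constr Q lam j) z.
Proof.
move=> Plam; case: j => [[i|i]|i].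
- exact: (sa_g_C1 HQ Plam i).1.
- exact: (sa_h_C1 HQ i).1.
rewrite (_ : constr Q lam (inr i) = \sum_j (row_mx (pA Q) (pB Q) i j *:
  (fun u : 'cV[R]_(n + m) => u j 0 : R)) + cst (- pb Q i 0)).
  apply: differentiableD; last exact: differentiable_cst.
  apply: differentiable_sum => j; apply: differentiableZ.
  exact: differentiable_coord.
apply/funext => u; rewrite constr_linE !mxE fctE fct_sumE; congr (_ + _).
Qed.

Lemma feasible_Omega (X : set (@mpoint R n m)) (lam : 'cV[R]_k) : pP Q lam ->
  feasible Q lam `<=` Omega Q X lam.
Proof.
move=> Plam z Fz; have /feasible_constr cz := Fz.
have lin zbar j : linearization (constr Q lam j) (emb zbar) (emb z) <= 0.
  apply: le_trans (cz j); apply: linearization_le; first exact: constr_convex.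
  exact: constr_differentiable.
split; first by case: Fz.
move=> zbar _; split=> i; first exact: (lin zbar (inl (inl i))).
exact: (lin zbar (inl (inr i))).
Qed.

(** Since [(x, y)] is itself a linearization point, the cuts at active constraints say that no
    active gradient increases along [xhat - x]; the common [y] cancels from the objectives. *)
Lemma NLP_minimizer_le_Omega (X : set (@mpoint R n m)) (lam : 'cV[R]_k)
    (y : 'cV[int]_m) (x xhat : 'cV[R]_n) : pP Q lam ->
  is_minimizer (NLP_set Q y lam) (NLP_obj Q y) x ->
  X (x, y) -> Omega Q X lam (xhat, y) ->
  objective Q (x, y) <= objective Q (xhat, y).
Proof.
move=> Plam xmin Xx [Lxhat /(_ _ Xx)[ling linh]].
pose F j u := constr Q lam j (emb (u, y)).
have dE j := constr_differentiable j (emb (x, y)) Plam.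
(* LICQ speaks of gradients in [x] alone, the cuts of full gradients; writing [F j] as an affine
   slice relates the two. *)
have FE j : F j = fun u => constr Q lam j (embx *m u + col_mx 0 (toR y)).
  by apply/funext => u; rewrite /F embE.
have gE j v :
  dotmul (grad (F j) x) v = 'D_(embx *m v) (constr Q lam j) (emb (x, y)).
  by rewrite FE dotmul_grad_slice -embE.
have dF j v : is_derive x v (F j) (dotmul (grad (F j) x) v).
  by rewrite gE FE embE; apply: is_derive_slice; rewrite -embE.
have lin j : linearization (constr Q lam j) (emb (x, y)) (emb (xhat, y)) <= 0.
  case: j => [[i|i]|i]; [exact: ling|exact: linh|].
  (* [Omega] keeps the linear constraints themselves, and these dominate their linearizations. *)
  apply: le_trans (linearization_le _ (constr_convex _ Plam) (dE _)) _.
  by rewrite constr_lin_le0; exact: Lxhat.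
have : 0 <= dotmul (pc Q) (xhat - x).
  apply: (free_active_grad_dotmul_ge0 dF).
  - exact: (sa_LICQ HQ Plam xmin).
  - case: xmin => /feasible_constr Fx xmin; split=> // u Fu.
    have /xmin : NLP_set Q y lam u by apply/feasible_constr.
    by rewrite /NLP_obj /objective lerD2r.
  - move=> j Fj0; have := lin j; rewrite /linearization -/(F j x) Fj0 add0r.
    (* The integer parts coincide, so the difference of the two points is [embx *m (xhat - x)]. *)
    by rewrite dotmul_grad// gE !embE opprD addrACA subrr addr0 mulmxBr.
by rewrite dotmulDr -scaleN1r dotmulZr mulN1r subr_ge0 /objective lerD2r.
Qed.

End OuterApproximation.

Unset Implicit Arguments.
Theorem theorem8 (R : realType) (n m k p q r : nat)
    (Q : minlp R n m k p q r) (HQ : standing_assumptions Q)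
    (lam0 lam1 : 'cV[R]_k) (Hlam0 : pP Q lam0) (Hlam1 : pP Q lam1)
    (x0 : 'cV[R]_n) (y0 : 'cV[int]_m)
    (Hopt0 : is_minimizer (feasible Q lam0) (objective Q) (x0, y0))
    (X0 : set ('cV[R]_n * 'cV[int]_m)) (HX0 : finite_set X0)
    (eps : R) (Heps : 0 <= eps) (yinit : 'cV[int]_m)
    (Xinit : set ('cV[R]_n * 'cV[int]_m)) (HXinit : finite_set Xinit)
    (Hfound : oa_returns Q lam0 eps yinit Xinit (x0, y0) X0)
    (Hx0X0 : X0 (x0, y0))
    (x1 : 'cV[R]_n)
    (Hx1 : is_minimizer (NLP_set Q y0 lam1) (NLP_obj Q y0) x1)
    (X1 : set ('cV[R]_n * 'cV[int]_m)) (HX1 : X1 = X0 `|` [set (x1, y0)])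
    (Hmilp : exists xhat : 'cV[R]_n,
       is_minimizer (Omega Q X1 lam1) (objective Q) (xhat, y0)) :
  is_minimizer (feasible Q lam1) (objective Q) (x1, y0) /\
  (exists S, oa_iter Q lam1 (oa_init y0 X0) x1 S) /\
  (forall S, oa_iter Q lam1 (oa_init y0 X0) x1 S ->
     [/\ oa_UB S = (objective Q (x1, y0))%:E,
         oa_LB S = opt_value (Omega Q X1 lam1) (objective Q)
       & oa_converged S]).
Proof.
case: Hmilp => xhat [Oxhat xhatmin].
have X1x : X1 (x1, y0) by rewrite HX1; right.
have Fx1 : feasible Q lam1 (x1, y0) by case: Hx1.
have x1O : is_minimizer (Omega Q X1 lam1) (objective Q) (x1, y0).
  split=> [|z /xhatmin]; first exact: (feasible_Omega HQ).
  by apply: le_trans; apply: (NLP_minimizer_le_Omega HQ Hlam1 Hx1 X1x).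
(* A minimizer over a relaxation that is feasible for the original problem is optimal there. *)
split; first by split=> // z /(feasible_Omega HQ X1 Hlam1)/x1O.2.
have vNLP := opt_valueE Hx1.
have vMILP := opt_valueE x1O.
split.
  (* Choosing [(x1, y0)] as the MILP solution makes [y0] the next assignment again; the finite NLP
     value beats the initial upper bound [+oo]. *)
  exists (OAState y0 X1 (objective Q (x1, y0))%:E (objective Q (x1, y0))%:E
    (Some (x1, y0))).
  split; [split=> [_|[]]|by []|by []|by exists x1]; last by exists x1.
  by rewrite vNLP /= ltry.
(* Feasibility of [x1] selects the NLP branch. Both bounds depend only on optimal values, so the
   choice of MILP solution in [S] does not affect them. *)
move=> S [[/(_ (ex_intro _ x1 Fx1))[_ UBE _] _] XE LBE _].
have XS : oa_X S = X1 by rewrite XE HX1.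
rewrite /oa_converged LBE XS UBE /= vNLP ltry vMILP.
by split.
Qed.
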